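(* The 0-1 law for typicality degrees of properties of a relational language fails in general: there exist a finite relational first-order language $L$ and a property $\phi(x)$ of $L$ for which neither $d(\phi:\mathrm{typ})=0$ nor $d(\phi:\mathrm{typ})=1$ holds.
   Context: A relational language is one with no function or constant symbols. For a finite language $L$ let $\mathbf{S}_n(L)$ be the set of $L$-structures with universe $\{1,\ldots,n\}$. A property of $L$ is a first-order $L$-formula $\phi(x)$ with one free variable and without parameters; for an $L$-structure $\mathcal{M}$ with universe $M$, $\phi(\mathcal{M})=\{a\in M:\mathcal{M}\models\phi(a)\}$. Let $\mathbf{S}_n(\phi:\mathrm{typ})=\{\mathcal{M}\in\mathbf{S}_n(L):|\phi(\mathcal{M})|>n/2\}$, $d_n(\phi:\mathrm{typ})=|\mathbf{S}_n(\phi:\mathrm{typ})|/|\mathbf{S}_n(L)|$, and $d(\phi:\mathrm{typ})=\lim_{n\to\infty}d_n(\phi:\mathrm{typ})$ whenever this limit exists. The 0-1 law holds for typicality degrees of properties of $L$ if for every $L$-property $\phi(x)$ either $d(\phi:\mathrm{typ})=0$ or $d(\phi:\mathrm{typ})=1$. *)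

(* Defs.v *)
From HB Require Import structures.
From mathcomp Require Import all_boot all_order all_algebra.
From mathcomp Require Import all_classical all_reals all_analysis.
Import Order.TTheory GRing.Theory Num.Theory.
Import numFieldNormedType.Exports.

Set Implicit Arguments.
Unset Strict Implicit.
Unset Printing Implicit Defensive.

(* A nullary relation symbol is a propositional constant, hence the positivity
   of arities. *)
Record language : Type := Language {
  rel_symbol :> finType;
  arity : rel_symbol -> nat;
  arity_gt0 : forall r, 0 < arity r }.

(* Well-scoped first-order formulas with equality: the free variables of an
   element of [formula L k] are among the de Bruijn indices 0, ..., k - 1; a
   quantifier binds index 0 and shifts the others. *)
Inductive formula (L : language) : nat -> Type :=
| FEq k (i j : 'I_k) : formula L k
| FRel k (r : L) (args : (arity r).-tuple 'I_k) : formula L k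
| FNot k (f : formula L k) : formula L k
| FAnd k (f g : formula L k) : formula L k
| FOr k (f g : formula L k) : formula L k
| FImp k (f g : formula L k) : formula L k
| FAll k (f : formula L k.+1) : formula L k
| FEx k (f : formula L k.+1) : formula L k.

Definition property (L : language) : Type := formula L 1.

Notation structure L M := {dffun forall r : rel_symbol L, {set (arity r).-tuple M}}.

Fixpoint sat (L : language) (M : finType) (S : structure L M) (k : nat)
    (f : formula L k) {struct f} : k.-tuple M -> bool :=
  match f in formula _ k return k.-tuple M -> bool with
  | FEq _ i j => fun v => tnth v i == tnth v j
  | FRel _ r args => fun v => map_tuple (tnth v) args \in S r
  | FNot _ f => fun v => ~~ sat S f v
  | FAnd _ f g => fun v => sat S f v && sat S g v
  | FOr _ f g => fun v => sat S f v || sat S g v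
  | FImp _ f g => fun v => sat S f v ==> sat S g v
  | FAll _ f => fun v => [forall a : M, sat S f [tuple of a :: v]]
  | FEx _ f => fun v => [exists a : M, sat S f [tuple of a :: v]]
  end.

Definition extension (L : language) (M : finType) (S : structure L M)
  (phi : property L) : {set M} := [set a | sat S phi [tuple a]].

(* The universe {1, ..., n} is represented by ['I_n] = {0, ..., n - 1}. *)
Definition typ_structures (L : language) (phi : property L) (n : nat) :
    {set structure L 'I_n} :=
  [set S | (n%:R / 2 < #|extension S phi|%:R :> rat)%R].

Definition typ_density (R : realType) (L : language) (phi : property L)
    (n : nat) : R :=
  (#|typ_structures phi n|%:R / #|{: structure L 'I_n}|%:R)%R.

(* A relation, since the limit need not exist. *)
Definition has_typ_degree (R : realType) (L : language) (phi : property L)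
    (d : R) : Prop :=
  (typ_density R phi n @[n --> \oo] --> d)%classic.

Definition typ_zero_one_law (R : realType) (L : language) : Prop :=
  forall phi : property L,
    has_typ_degree phi (0 : R)%R \/ has_typ_degree phi (1 : R)%R.

(* Main.v *)
(** For a single unary predicate [P], complementing [P] is an involution of the
    structures on [n] points. When [n] is odd exactly one of [P] and its
    complement holds at more than [n/2] points, so the density of "[P] is
    typical" is [1/2] along the odd integers, and [1/2] is its only possible
    limit. *)
Require Import Defs.
From HB Require Import structures.
From mathcomp Require Import all_boot all_order all_algebra.
From mathcomp Require Import all_classical all_reals all_analysis.
From mathcomp Require Import zify lra.
Import Order.TTheory GRing.Theory Num.Theory.
Import numFieldNormedType.Exports.

Set Implicit Arguments.
Unset Strict Implicit.
Unset Printing Implicit Defensive.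

Definition unary_language : language :=
  @Language unit (fun=> 1) (fun=> erefl).

Definition unary_property : property unary_language :=
  @FRel unary_language 1 tt [tuple ord0].

Definition compl_structure (L : language) (M : finType) (S : structure L M) :
  structure L M := [ffun r => ~: S r].

Lemma compl_structureK (L : language) (M : finType) :
  involutive (@compl_structure L M).
Proof. by move=> S; apply/ffunP => r; rewrite !ffunE finset.setCK. Qed.

Lemma extension_compl_structure (M : finType) (S : structure unary_language M) :
  extension (compl_structure S) unary_property = ~: extension S unary_property.
Proof. by apply/setP => a; rewrite !inE /= ffunE inE. Qed.

(** Clearing the denominator moves the majority condition from [rat] to [nat], within reach of
    [lia]. *)
Lemma typ_structuresE (L : language) (phi : property L) n
    (S : structure L 'I_n) :
  (S \in typ_structures phi n) = (n < #|extension S phi|.*2).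
Proof.
by rewrite inE ltr_pdivrMr // -natrM ltr_nat muln2.
Qed.

(** The two extensions partition the [n] points, and oddness excludes a tie, the one case where
    neither is a majority. *)
Lemma typ_structures_compl n (S : structure unary_language 'I_n) : odd n ->
  (compl_structure S \in typ_structures unary_property n) =
  (S \notin typ_structures unary_property n).
Proof.
move=> n_odd; rewrite !typ_structuresE extension_compl_structure.
have := cardsC (extension S unary_property); rewrite card_ord; lia.
Qed.

Lemma card_typ_structures n : odd n ->
  #|{: structure unary_language 'I_n}| = #|typ_structures unary_property n|.*2.
Proof.
move=> n_odd; rewrite -(cardsC (typ_structures unary_property n)) -addnn.
congr addn.
pose complK := @compl_structureK unary_language 'I_n.
(* Complementation is injective, so it suffices that it maps the typical structures onto the
   atypical ones. *)
rewrite -[RHS](card_imset _ (can_inj complK)); apply: eq_card => S.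
rewrite (can2_imset_pre _ complK complK) finset.in_setC.
by rewrite [RHS]finset.inE typ_structures_compl.
Qed.

Lemma typ_density_unary (R : realType) n : odd n ->
  typ_density R unary_property n = (2^-1)%R.
Proof.
move=> n_odd.
(* The cancellation below needs a nonzero count; the structure with empty [P] provides it. *)
have card_gt0 : 0 < #|{: structure unary_language 'I_n}|.
  by apply/card_gt0P; exists [ffun=> finset.set0].
rewrite /typ_density; move: card_gt0.
rewrite (card_typ_structures n_odd) double_gt0 => typ_gt0.
rewrite -muln2 natrM invfM mulrA divff ?mul1r //.
by rewrite pnatr_eq0 -lt0n.
Qed.

Lemma has_typ_degree_unary (R : realType) (d : R) :
  has_typ_degree unary_property d -> d = (2^-1)%R.
Proof.
(* If [d] differs from 1/2, the distance between them serves as the epsilon of convergence. *)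
move=> /cvgrPdist_lt cvg_d; apply: subr0_eq; apply/eqP; rewrite -normr_le0 leNgt.
apply/negP => gap.
have [N _ near_d] := cvg_d _ gap.
(* [N.*2.+1] is an odd index past [N]: there the distance equals that epsilon, yet must be strictly
   smaller. *)
have := near_d N.*2.+1 _; rewrite typ_density_unary /= ?odd_double //.
by rewrite ltxx => /(_ _)/notF; apply; lia.
Qed.

Theorem corollary4p5 (R : realType) :
  ~ (forall L : language, typ_zero_one_law R L) /\
  exists (L : language) (phi : property L),
    ~ has_typ_degree phi (0 : R)%R /\ ~ has_typ_degree phi (1 : R)%R.
Proof.
have not0 : ~ has_typ_degree unary_property (0 : R)%R.
  by move=> /has_typ_degree_unary; lra.
have not1 : ~ has_typ_degree unary_property (1 : R)%R.
  by move=> /has_typ_degree_unary; lra.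
split; last by exists unary_language, unary_property.
by move=> /(_ unary_language unary_property) [].
Qed.
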